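(* (1) The set of terms of $\mathcal{V}(1,2)$ is $\{2\}\cup\{1,3,5,7,\dots\}$, i.e. $\{2\}$ together with all positive odd integers. (2) The set of terms of $\mathcal{V}(1,3)$ is $\{4\}\cup\{1,3,5,7,\dots\}$, i.e. $\{4\}$ together with all positive odd integers.
   Context: For positive integers $a<b$, the sequence $\mathcal{V}(a,b)=(a_m)_{m\geqslant 1}$ is defined greedily by $a_1=a$, $a_2=b$, and, for $m\geqslant 2$, $a_{m+1}$ is the smallest integer larger than $a_m$ that can be written as $a_i+a_j$ with $i\leqslant j\leqslant m$ (the two earlier terms not necessarily distinct) in exactly one way (representations are unordered pairs). *)

(* Defs.v *)
From mathcomp Require Import all_boot.

Set Implicit Arguments.
Unset Strict Implicit.
Unset Printing Implicit Defensive.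

(* Representations are counted by index pairs i <= j; for the strictly
   increasing sequences considered here these are the unordered pairs of
   (not necessarily distinct) terms. *)
Definition nrep (s : seq nat) (n : nat) : nat :=
  #|[set p : 'I_(size s) * 'I_(size s) |
      (p.1 <= p.2) && (nth 0 s p.1 + nth 0 s p.2 == n)]|.

(* The least n > l with exactly one representation, l being the last term.
   The search is limited to l < n <= 2l without loss, because 2l = l + l is
   always uniquely represented; [V_spec] below gives the unbounded
   characterization. *)
Definition next_term (s : seq nat) : nat :=
  let l := last 0 s in head 0 [seq n <- iota l.+1 l | nrep s n == 1].

Fixpoint V_prefix (a b k : nat) : seq nat :=
  if k is k'.+1 then rcons (V_prefix a b k') (next_term (V_prefix a b k'))
  else [:: a; b].

(* Indices start at 0: V a b m is the term usually written a_(m+1). *)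
Definition V (a b m : nat) : nat := nth 0 (V_prefix a b m) m.

Definition is_term (a b n : nat) : Prop := exists m, V a b m = n.

Lemma size_V_prefix a b k : size (V_prefix a b k) = k.+2.
Proof. by elim: k => //= k IH; rewrite size_rcons IH. Qed.

Lemma nth_V_prefix a b k i : i < k.+2 -> nth 0 (V_prefix a b k) i = V a b i.
Proof.
have step j d : j < d.+2 ->
    nth 0 (V_prefix a b d.+1) j = nth 0 (V_prefix a b d) j.
  by move=> jd; rewrite /= nth_rcons size_V_prefix jd.
have mono j d e : j < d.+2 ->
    nth 0 (V_prefix a b (e + d)) j = nth 0 (V_prefix a b d) j.
  move=> jd; elim: e => // e IH; rewrite addSn step ?IH //.
  by rewrite (leq_trans jd) // !ltnS leq_addl.
move=> ik; rewrite /V; case: (leqP i k) => [le|lt].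
  by rewrite -(subnK le) mono.
have -> : i = k.+1 by apply/eqP; rewrite eqn_leq lt -ltnS ik.
by rewrite step.
Qed.

Lemma V_prefixE a b k : V_prefix a b k = mkseq (V a b) k.+2.
Proof.
apply: (@eq_from_nth _ 0); rewrite size_V_prefix ?size_mkseq // => i ik.
by rewrite nth_V_prefix // nth_mkseq.
Qed.

Lemma nrep_double_last s : sorted ltn s -> s != [::] ->
  nrep s (last 0 s + last 0 s) = 1.
Proof.
case: s => // x s' srt _; set s := x :: s' in srt *.
have hm : size s' < size s by [].
pose m : 'I_(size s) := Ordinal hm.
have lE : last 0 s = nth 0 s m by rewrite -nth_last.
have lt (i : 'I_(size s)) : i != m -> nth 0 s i < nth 0 s m.
  move=> im; apply: (sorted_ltn_nth ltn_trans 0 srt); rewrite ?inE //.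
  by rewrite ltn_neqAle -(inj_eq val_inj) in im *; rewrite im -ltnS ltn_ord.
rewrite /nrep lE; apply/eqP/cards1P; exists (m, m); apply/setP=> -[i j].
rewrite !inE xpair_eqE /=; case: (eqVneq i m) => [->|/lt im]; last first.
  apply/negP => /andP[_ /eqP e].
  have: nth 0 s j <= nth 0 s m by case: (eqVneq j m) => [->|/lt/ltnW].
  by move=> jm; have := leq_add im jm; rewrite addSn e ltnn.
rewrite eqn_add2l; case: (eqVneq j m) => [->|jm]; first by rewrite leqnn eqxx.
by rewrite (ltn_eqF (lt _ jm)) andbF.
Qed.

Lemma next_termP s : sorted ltn s -> 0 < last 0 s ->
  [/\ last 0 s < next_term s, nrep s (next_term s) = 1
    & forall n, last 0 s < n -> nrep s n = 1 -> next_term s <= n].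
Proof.
move=> srt l0; have sn0 : s != [::] by case: s l0 {srt}.
have := nrep_double_last srt sn0; rewrite /next_term.
set l := last 0 s in l0 * => r2.
set t := [seq n <- _ | _].
have mem n : (n \in t) = [&& nrep s n == 1, l < n & n <= l + l].
  by rewrite mem_filter mem_iota addSn ltnS.
have tl : l + l \in t by rewrite mem r2 eqxx leqnn -addn1 leq_add2l l0.
have st : sorted ltn t by rewrite sorted_filter ?iota_ltn_sorted //; exact: ltn_trans.
have hmin n : n \in t -> head 0 t <= n.
  case: (t) st => // y t' /= /(order_path_min ltn_trans)/allP yt.
  by rewrite inE => /orP[/eqP ->|/yt/ltnW].
have : head 0 t \in t by case: (t) tl => // y t' _; rewrite mem_head.
rewrite {1}mem => /and3P[/eqP h1 h2 h3]; split=> // n ln rn.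
case: (leqP n (l + l)) => [nl|/ltnW]; last exact: leq_trans.
by apply: hmin; rewrite mem rn eqxx ln nl.
Qed.

Lemma V_prefix_sorted a b k : 0 < a < b ->
  sorted ltn (V_prefix a b k) /\ 0 < last 0 (V_prefix a b k).
Proof.
case/andP=> a0 ab; elim: k => [|k [srt l0]] /=.
  by rewrite ab (ltn_trans a0 ab).
have [lt _ _] := next_termP srt l0.
rewrite last_rcons (ltn_trans l0 lt); split=> //.
case: (V_prefix a b k) srt l0 lt => // x s' /= srt l0 lt.
by rewrite rcons_path srt.
Qed.

Lemma V_spec a b : 0 < a < b ->
  [/\ V a b 0 = a, V a b 1 = b &
      forall m, 2 <= m ->
        [/\ V a b m.-1 < V a b m,
            nrep (mkseq (V a b) m) (V a b m) = 1
          & forall n, V a b m.-1 < n -> nrep (mkseq (V a b) m) n = 1 ->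
                      V a b m <= n]].
Proof.
move=> h; split=> // -[|[|k]] // _; rewrite -V_prefixE.
have [srt l0] := V_prefix_sorted k h.
have <- : last 0 (V_prefix a b k) = V a b k.+1.
  by rewrite -nth_last size_V_prefix nth_V_prefix.
have -> : V a b k.+2 = next_term (V_prefix a b k).
  by rewrite -(@nth_V_prefix a b k.+1) //= nth_rcons size_V_prefix ltnn eqxx.
exact: next_termP.
Qed.

(* Main.v *)
Require Import Defs.
From mathcomp Require Import all_boot.
From mathcomp Require Import zify.

(** Both sequences soon reach a stage where the terms are a single even number
    [e] and all the odd numbers up to some [2k+1].  From there on, [2k+2] has at
    least the two representations [1 + (2k+1)] and [3 + (2k-1)] (or [1 + 3] and
    [2 + 2] when [k = 1]), whereas a representation of the odd number [2k+3] must
    use [e], the only even term, so that it is unique.  Hence the next term is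
    [2k+3] and the same situation recurs. *)

Lemma sorted_ltn_leq_nth (s : seq nat) i j : sorted ltn s ->
  i < size s -> j < size s -> (nth 0 s i <= nth 0 s j) = (i <= j).
Proof.
move=> srt hi hj; have lt := sorted_ltn_nth ltn_trans 0 srt.
case: (ltngtP i j) => [ij|ji|->]; last exact: leqnn.
- by rewrite ltnW // lt.
- by apply/negbTE; rewrite -ltnNge lt.
Qed.

(** Bridge from values to the index pairs counted by [nrep]: a sorted list has no repeated entries,
    so terms and indices correspond. Constraining [u] alone suffices, since the sum fixes [v]. *)
Lemma nrep_unique (s : seq nat) (n x y : nat) : sorted ltn s ->
    x \in s -> y \in s -> x + y = n ->
    (forall u v : nat, u \in s -> v \in s -> u + v = n -> u = x \/ u = y) ->
  nrep s n = 1.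
Proof.
move=> srt; wlog xy : x y / x <= y => [hw|xs ys xyn huniq].
  move=> xs ys xyn huniq; case: (leqP x y) => [/hw|/ltnW/hw]; first exact.
  apply=> //; first by rewrite addnC.
  by move=> u v us vs /(huniq _ _ us vs)[]; [right|left].
have us : uniq s by apply: (sorted_uniq ltn_trans ltnn).
have hx : index x s < size s by rewrite index_mem.
have hy : index y s < size s by rewrite index_mem.
apply/eqP/cards1P; exists (Ordinal hx, Ordinal hy); apply/setP=> -[i j].
rewrite !inE xpair_eqE -!(inj_eq val_inj) /=.
apply/andP/andP => [[ij /eqP sum]|[/eqP-> /eqP->]]; last first.
  by rewrite -(sorted_ltn_leq_nth s) // !nth_index // xyn eqxx.
rewrite -(sorted_ltn_leq_nth s) // in ij.
have hi : nth 0 s i = x \/ nth 0 s i = y.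
  by apply: huniq sum; exact: mem_nth.
(* Both pairs are in increasing order with sum [n], so they agree entry by entry. *)
have [ix jy] : nth 0 s i = x /\ nth 0 s j = y by lia.
by rewrite -ix -jy !index_uniq.
Qed.

(** If the two index pairs coincided, [u] or [v] would be one of [x], [y]; as the sums agree, [u]
    would then be one of them in either case. *)
Lemma nrep_not_unique (s : seq nat) (n x y u v : nat) : sorted ltn s ->
    x \in s -> y \in s -> u \in s -> v \in s ->
    x + y = n -> u + v = n -> u != x -> u != y ->
  nrep s n <> 1.
Proof.
move=> srt xs ys us vs xyn uvn ux uy.
have rep z t : z \in s -> t \in s -> z + t = n ->
    exists i j : 'I_(size s), [/\ (i <= j) && (nth 0 s i + nth 0 s j == n)
      & nth 0 s i = z \/ nth 0 s i = t].
  wlog zt : z t / z <= t => [hw|zs ts ztn].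
    move=> zs ts ztn; case: (leqP z t) => [/hw|/ltnW/hw hw']; first exact.
    have [|i [j [ij h]]] := hw' ts zs; first by rewrite addnC.
    by exists i, j; split=> //; case: h; [right|left].
  have hz : index z s < size s by rewrite index_mem.
  have ht : index t s < size s by rewrite index_mem.
  exists (Ordinal hz), (Ordinal ht).
  rewrite -(sorted_ltn_leq_nth s) //= !nth_index // zt ztn eqxx.
  by split; last left.
have [i [j [ij hi]]] := rep x y xs ys xyn.
have [i' [j' [ij' hi']]] := rep u v us vs uvn.
move=> /eqP/cards1P[p /setP hp].
have := hp (i, j); have := hp (i', j').
rewrite !inE /= ij ij' => /esym/eqP <- /esym; rewrite xpair_eqE.
by move=> /andP[/eqP ii _]; rewrite ii in hi; lia.
Qed.

Lemma next_term_succ (s : seq nat) : sorted ltn s -> 0 < last 0 s ->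
  nrep s (last 0 s).+1 = 1 -> next_term s = (last 0 s).+1.
Proof.
move=> srt l0 r1; have [lt _ hmin] := next_termP srt l0.
by apply/eqP; rewrite eqn_leq lt hmin.
Qed.

Definition even_or_odds (e k : nat) : pred nat :=
  [pred x | (x == e) || odd x && (x <= k.*2.+1)].

Lemma next_term_even_or_odds (s : seq nat) e k :
    sorted ltn s -> last 0 s = k.*2.+1 -> s =i even_or_odds e k ->
    ~~ odd e -> 0 < e <= k.*2 -> (e == 2) || (1 < k) ->
  next_term s = k.+1.*2.+1.
Proof.
move=> srt lastE memE ev ek e2.
have [] := next_termP srt; first by rewrite lastE.
rewrite lastE => lt r1 hmin.
have r3 : nrep s k.*2.+3 = 1.
  (* The partner of [e] is odd, and at most [k.*2.+1] because [e] is at least 2. *)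
  apply: (@nrep_unique _ _ e (k.*2.+3 - e)) => //; rewrite ?memE ?inE //=; try lia.
  by move=> u v; rewrite !memE !inE; lia.
have r2 : nrep s k.*2.+2 <> 1.
  (* For [k = 1] the sums 1 + (2k+1) and 3 + (2k-1) are the same pair; there [e = 2] supplies 2 + 2
     instead. *)
  case: (leqP k 1) => k1.
    apply: (@nrep_not_unique _ _ 1 k.*2.+1 2 2) => //; rewrite ?memE ?inE //=; lia.
  by apply: (@nrep_not_unique _ _ 1 k.*2.+1 3 k.*2.-1) => //;
    rewrite ?memE ?inE //=; lia.
have := hmin _ _ r3; have : next_term s <> k.*2.+2 by move=> h; rewrite h in r1.
by lia.
Qed.

(** Here [c] is the stage at which the pattern sets in; each further step raises the bound [k] by
    one. *)
Lemma is_term_even_or_odds a b c e k : 0 < a < b ->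
    last 0 (V_prefix a b c) = k.*2.+1 -> V_prefix a b c =i even_or_odds e k ->
    ~~ odd e -> 0 < e <= k.*2 -> (e == 2) || (1 < k) ->
  forall n, is_term a b n <-> n = e \/ odd n.
Proof.
move=> ab last0 mem0 ev ek e2.
have inv d : last 0 (V_prefix a b (d + c)) = (d + k).*2.+1 /\
             V_prefix a b (d + c) =i even_or_odds e (d + k).
  elim: d => // d [lastE memE]; rewrite !addSn /=.
  have [srt _] := V_prefix_sorted (d + c) ab.
  rewrite (next_term_even_or_odds _ _ _ srt lastE memE) //; try lia.
  rewrite last_rcons; split=> // x.
  by rewrite mem_rcons inE memE !inE; lia.
move=> n; split=> [[m <-]|ne].
  rewrite -(@nth_V_prefix _ _ (m + c)); last by lia.
  set x := nth _ _ _; have : x \in V_prefix a b (m + c).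
    by rewrite mem_nth // size_V_prefix; lia.
  by rewrite (inv m).2 inE; lia.
(* After [n] further steps the odd terms reach [(n + k).*2.+1], which exceeds [n]. *)
have : n \in V_prefix a b (n + c) by rewrite (inv n).2 inE; lia.
move=> /(nthP 0)[i]; rewrite size_V_prefix => hi <-.
by exists i; rewrite nth_V_prefix.
Qed.

Theorem theorem2p1 :
  (forall n : nat, is_term 1 2 n <-> n = 2 \/ odd n) /\
  (forall n : nat, is_term 1 3 n <-> n = 4 \/ odd n).
Proof.
split.
- have p1 : V_prefix 1 2 1 = [:: 1; 2; 3].
    rewrite /= next_term_succ //=.
    by apply: (@nrep_unique _ _ 1 2) => // u v; rewrite !inE; lia.
  apply: (@is_term_even_or_odds _ _ 1 2 1) => //; rewrite p1 // => x.
  by rewrite !inE; lia.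
- have p1 : V_prefix 1 3 1 = [:: 1; 3; 4].
    rewrite /= next_term_succ //=.
    by apply: (@nrep_unique _ _ 1 3) => // u v; rewrite !inE; lia.
  (* The prefix 1, 3, 4 ends in an even term; one more step, 5 = 1 + 4, starts the pattern with
     [e = 4] and [k = 2]. *)
  have p2 : V_prefix 1 3 2 = [:: 1; 3; 4; 5].
    rewrite -[LHS]/(rcons (V_prefix 1 3 1) (next_term (V_prefix 1 3 1))) p1.
    rewrite next_term_succ //=.
    by apply: (@nrep_unique _ _ 1 4) => // u v; rewrite !inE; lia.
  apply: (@is_term_even_or_odds _ _ 2 4 2) => //; rewrite p2 // => x.
  by rewrite !inE; lia.
Qed.
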